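(* For the nonhomogeneous difference equation $$y(t+1)-\lambda y(t)=f(t),\qquad \lambda\neq 0,$$ a particular solution can be written as an antidifference of $f$ given by a convolution, $$y_p(t)=G(t;\lambda)\ast f(t),$$ where $$G(t;\lambda)=\sum_{s=1}^{\lfloor t\rfloor}\lambda^{s-1}\delta(t-s).$$
   Context: $f:\mathbb{R}\to\mathbb{R}$ is a given function, $\lambda$ is a constant, $\lfloor t\rfloor$ is the usual floor function and $\delta$ is theIrac-type unit impulse known as the Dirac delta. The convolution is $G(t;\lambda)\ast f(t)=\int_{-\infty}^{\infty}G(t-r;\lambda)f(r)\,dr$, evaluated formally with the upper limit of the sum kept at $\lfloor t\rfloor$, i.e. as $\int_{-\infty}^{\infty}\sum_{s=1}^{\lfloor t\rfloor}\lambda^{s-1}\delta(t-r-s)f(r)\,dr$. A sum whose upper limit is smaller than its lower limit equals $0$.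
   Formalization: The equation is asserted only for real t ≥ 0: for t < 0 both sums defining y_p(t+1) and y_p(t) are empty, so the left side is 0 and the claim fails whenever f(t) ≠ 0 (e.g. f = 1, t = −1). *)

(* Defs.v *)
From mathcomp Require Import all_boot all_order all_algebra.
From mathcomp Require Import all_classical all_reals all_analysis.

Set Implicit Arguments.
Unset Strict Implicit.
Unset Printing Implicit Defensive.

Import Order.TTheory GRing.Theory Num.Theory.
Import numFieldNormedType.Exports.

Local Open Scope ring_scope.

(* A generalized function u on the line is represented by its pairing
   phi |-> \int_(-oo)^(+oo) u(x) phi(x) dx with real functions; since the
   integrals are formal, phi is an arbitrary function. *)
Definition genfun (R : realType) := (R -> R) -> R.

(* The unit impulse: the pairing with phi is the integral of phi against the
   Dirac measure at 0.  (That integral equals phi 0 even when phi is not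
   measurable: the library integral of a nonnegative function is a supremum
   over simple functions below it, and singletons are measurable.) *)
Definition dirac_delta (R : realType) : genfun R :=
  fun phi => \int[\d_(0 : R)]_x phi x.

(* u(x - a), by the change of variable x := x + a in the pairing *)
Definition translate (R : realType) (a : R) (u : genfun R) : genfun R :=
  fun phi => u (fun x => phi (x + a)).

(* u(a - r) as a generalized function of r, by the change of variable
   r := a - x in the pairing *)
Definition reflect_at (R : realType) (a : R) (u : genfun R) : genfun R :=
  fun phi => u (fun x => phi (a - x)).

(* \sum_(s = 1)^(floor t) lam^(s-1) delta(x - s), as a generalized function of
   x; the parameter t only enters through the upper limit of the sum.  The sum
   is empty if floor t is negative (Negz) or zero. *)
Definition G (R : realType) (lam t : R) : genfun R :=
  if Num.floor t is Posz n then
    \sum_(1 <= s < n.+1) (lam ^+ (s - 1) \*o translate s%:R (@dirac_delta R))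
  else 0.

(* \int_(-oo)^(+oo) K_t(t - r) f(r) dr for a kernel K_t depending on the time t:
   the parameter t of the kernel is held fixed while its argument becomes
   t - r. *)
Definition convolution (R : realType) (K : R -> genfun R) (f : R -> R) (t : R) : R :=
  reflect_at t (K t) f.

(* Main.v *)
Require Import Defs.
From mathcomp Require Import all_boot all_order all_algebra.
From mathcomp Require Import all_classical all_reals all_analysis.
From mathcomp Require Import measurable_realfun lra.
Import Order.TTheory GRing.Theory Num.Theory.
Local Open Scope ring_scope.

(* Each impulse delta(t - r - s) evaluates f at r = t - s, so that
   y_p(t) = \sum_(1 <= s <= floor t) lam^(s-1) f(t - s).  Raising t by one
   adds one term: the s = 1 term of y_p(t + 1) is f(t), and its remaining
   terms, shifted by one index, are lam times those of y_p(t). *)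

Section integral_dirac_set1.
Context d (T : measurableType d) (R : realType) (a : T).
Hypothesis ma : measurable [set a]%classic.

Import HBNNSimple.

(** A simple function is measurable, so its integral against the Dirac measure is its value at
    [a]. *)
Lemma sintegral_dirac (h : {nnsfun T >-> R}) :
  sintegral (\d_a : measure T R) h = (h a)%:E.
Proof.
have := integral_nnsfun \d_a measurableT h; rewrite patch_setT => <-.
rewrite integral_dirac//; last exact/measurable_EFinP.
by rewrite diracT mul1e.
Qed.

(* The supremum over simple functions below g is attained at
   [g a * \1_[set a]], which is measurable even when g is not. *)
Lemma ge0_integral_dirac_set1 (g : T -> R) : (forall x, 0 <= g x) ->
  (\int[\d_a]_x (g x)%:E = (g a)%:E)%E.
Proof.
move=> g0; rewrite ge0_integralTE; last by move=> x; rewrite lee_fin.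
apply/eqP; rewrite eq_le; apply/andP; split.
  by apply: ge_ereal_sup => /= _ [h hg <-]; rewrite sintegral_dirac.
apply: ereal_sup_ubound; exists (scale_nnsfun (indic_nnsfun R ma) (g0 a)).
  move=> x; rewrite lee_fin/= /mindic indicE.
  have [/[!inE] ->|_] := boolP (x \in _); first by rewrite mulr1.
  by rewrite mulr0.
by rewrite sintegral_dirac/= /mindic indicE mem_set// mulr1.
Qed.

(** The nonnegative case applies to the positive and negative parts of [g], whose values at [a]
    differ by [g a]. *)
Lemma integral_dirac_set1 (g : T -> R) : (\int[\d_a]_x (g x)%:E = (g a)%:E)%E.
Proof.
rewrite integralE.
under eq_integral => x _ do rewrite funeposE -EFin_max.
under [X in (_ - X)%E]eq_integral => x _ do rewrite funenegE -EFinN -EFin_max.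
rewrite !ge0_integral_dirac_set1; [|by move=> x; rewrite le_max lexx orbT..].
rewrite -EFinB; congr EFin; rewrite !maxEle oppr_le0.
by case: (lerP (g a) 0) => [ga0|/ltW ga0]; case: lerP => //; rewrite ?subr0//; lra.
Qed.

End integral_dirac_set1.

Lemma dirac_deltaE (R : realType) (phi : R -> R) : dirac_delta phi = phi 0.
Proof. by rewrite /dirac_delta /Rintegral integral_dirac_set1. Qed.

(** The sum is reindexed from 0: its term [s] comes from the impulse at [s.+1]. *)
Lemma convolution_GE (R : realType) (lam : R) (f : R -> R) (n : nat) (t : R) :
  Num.floor t = n%:Z ->
  convolution (G lam) f t = \sum_(0 <= s < n) lam ^+ s * f (t - s.+1%:R).
Proof.
move=> tn; rewrite /convolution /reflect_at /G tn fct_sumE big_add1/=.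
by apply: eq_bigr => s _; rewrite /translate dirac_deltaE add0r subn1.
Qed.

Theorem theorem4p1 (R : realType) (lam : R) (hlam : lam != 0) (f : R -> R) :
  let yp := convolution (G lam) f in
  forall t : R, 0 <= t -> yp (t + 1) - lam * yp t = f t.
Proof.
move=> yp t t0.
(* [0 <= t] rules out the [Negz] branch of [G]. *)
have [n tn] : exists n : nat, Num.floor t = n%:Z.
  by case: (Num.floor t) (floor_ge0 t) => n; [exists n|rewrite t0].
have t1n : Num.floor (t + 1) = n.+1%:Z.
  by rewrite floorDrz ?rpred1// floor1 tn -addn1 PoszD.
rewrite /yp (convolution_GE _ _ _ _ _ t1n) (convolution_GE _ _ _ _ _ tn).
rewrite big_nat_recl// expr0 mul1r addrK mulr_sumr -addrA.
rewrite [X in _ + X](_ : _ = 0) ?addr0//; apply/eqP; rewrite subr_eq0; apply/eqP.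
(* The terms agree one by one, since [t + 1 - s.+2%:R = t - s.+1%:R]. *)
apply: eq_bigr => s _; rewrite exprS mulrA; congr (_ * f _).
by rewrite -[s.+2%:R]natr1 opprD addrACA subrr addr0.
Qed.
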